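(* There exists an absolute constant $\delta > 0$ such that for every finite subset $A$ of $\mathbb{R}^2$ and every $\theta \in (0,2\pi)\setminus\{\pi\}$, one has \[ |A + \mathscr{L}_{\theta}(A)| \geq 4|A| - O(|A|^{1-\delta}), \] where the implied constant is absolute.
   Context: $\mathscr{L}_\theta$ denotes the linear map of $\mathbb{R}^2$ that rotates vectors counterclockwise by angle $\theta$. For $A,B \subseteq \mathbb{R}^2$, $A+B = \{a+b : a\in A, b \in B\}$, and $\mathscr{L}_\theta(A) = \{\mathscr{L}_\theta(a) : a \in A\}$. The notation $X \geq Y - O(Z)$ means that there is a constant $K>0$ (here independent of $A$ and $\theta$) with $X \geq Y - KZ$. *)

(* Defs.v *)
From HB Require Import structures.
From mathcomp Require Import all_boot all_order all_algebra.
From mathcomp Require Import finmap.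
From mathcomp Require Import all_classical all_reals all_analysis.

Set Implicit Arguments.
Unset Strict Implicit.
Unset Printing Implicit Defensive.

Import Order.TTheory GRing.Theory Num.Theory.

Local Open Scope fset_scope.
Local Open Scope ring_scope.

(* Points of the plane are column vectors, so linear maps act by left
   multiplication. *)
Definition rot_mx (R : realType) (theta : R) : 'M[R]_2 :=
  \matrix_(i < 2, j < 2)
    if i == j then cos theta
    else if (i < j)%N then - sin theta else sin theta.

Definition rotation (R : realType) (theta : R) (v : 'cV[R]_2) : 'cV[R]_2 :=
  rot_mx theta *m v.

Definition sumset (V : zmodType) (A B : {fset V}) : {fset V} :=
  [fset a + b | a in A, b in B].

(* Main.v *)
Require Import Defs.
From HB Require Import structures.
From mathcomp Require Import all_boot all_order all_algebra.
From mathcomp Require Import finmap.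
From mathcomp Require Import all_classical all_reals all_analysis.
From mathcomp Require Import zify ring lra.

Set Implicit Arguments.
Unset Strict Implicit.
Unset Printing Implicit Defensive.

Import Order.TTheory GRing.Theory Num.Theory.

Local Open Scope fset_scope.
Local Open Scope ring_scope.

(** Let N = |A|, let B be the rotated copy of A, and suppose |A + B| < 4 N;
    otherwise there is nothing to prove.

    Cover A by m parallel lines in some direction w, and B by n lines in the same
    direction. Peeling off extreme lines shows that
      |A + B| >= (N/m + N/n - 1)(m + n - 1)
    ([sumset_line_cover]). Since 2 + m/n + n/m >= 4, this is 4 N up to the losses
    N/m, N/n, m and n. A rotation by an angle other than 0 and pi preserves no
    direction, so A also sits in an m by n grid and N <= m n
    ([card_le_projections]); hence N/m <= n and N/n <= m, while n > 4 m would already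
    force |A + B| >= 4 N. The total loss is therefore at most 10 m
    ([four_card_bound]), and it remains to find a direction in which m lines with
    m = O(N^(1 - delta)) cover A.

    For this it is enough to find w <> 0 and a progression P = {0, w, ..., (L-1) w},
    with L a power of N, such that A + P is not much larger than A: every line of
    direction w meeting A contains L points of A + P, so m L <= |A + P|
    ([progression_lines]). Such a P is found without Freiman's theorem
    ([absorbed_progression]). By the inequalities of Plunnecke and Ruzsa, in the form
    due to Petridis, all iterated sumsets of A are O(N), and a covering argument gives
    D + D <= X + D, where D = A - A and |X| <= k = 4^5. Doubling an element of D can
    thus be corrected back into D by an element of X. Iterating t times attaches to
    each element of D an itinerary in X^t; when k^t < |D|, two elements share one, and
    their difference w satisfies 2^i w \in D - D for all i <= t. Binary expansion then
    puts every j w with j < 2^t in the 2t-fold sumset of D, hence in D translated by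
    the 2t-fold sumset of X, which has at most (2t+1)^k elements. So A + P has size
    O(N (2t+1)^k) with |P| = 2^t a power of N: the loss is polylogarithmic and the gain
    is a power of N. *)

(** * Sumsets in an abelian group *)

Section Sumsets.
Variable V : zmodType.
Implicit Types (A B C D E S X Y Z : {fset V}) (v w x y z a b c : V).

Definition oppset A : {fset V} := [fset - a | a in A].
Definition nfold n A : {fset V} := iter n (sumset A) [fset 0].

Lemma sumsetP A B v :
  reflect (exists a b, [/\ a \in A, b \in B & v = a + b]) (v \in sumset A B).
Proof.
apply: (iffP idP) => [/imfset2P[a aA [b bB ->]]|[a [b [aA bB ->]]]].
  by exists a, b.
exact: in_imfset2.
Qed.

Lemma mem_sumset A B a b : a \in A -> b \in B -> a + b \in sumset A B.
Proof. by move=> aA bB; apply/sumsetP; exists a, b. Qed.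

Lemma in_oppset A v : (v \in oppset A) = (- v \in A).
Proof.
apply/imfsetP/idP => /= [[a aA ->]|vA]; first by rewrite opprK.
by exists (- v) => //; rewrite opprK.
Qed.

Lemma card_oppset A : #|` oppset A| = #|` A|.
Proof. by rewrite card_imfset //; exact: oppr_inj. Qed.

Lemma sumsetC A B : sumset A B = sumset B A.
Proof.
by apply/fsetP => v; apply/sumsetP/sumsetP => -[a [b [aA bB ->]]];
  exists b, a; rewrite addrC.
Qed.

Lemma sumsetA A B C : sumset A (sumset B C) = sumset (sumset A B) C.
Proof.
apply/fsetP => v; apply/sumsetP/sumsetP.
  move=> [a [_ [aA /sumsetP[b [c [bB cC ->]]] ->]]].
  by exists (a + b), c; rewrite addrA mem_sumset.
move=> [_ [c [/sumsetP[a [b [aA bB ->]]] cC ->]]].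
by exists a, (b + c); rewrite addrA mem_sumset.
Qed.

Lemma sumset0 A : sumset A [fset 0] = A.
Proof.
apply/fsetP => v; apply/sumsetP/idP => [[a [b [aA]]]|vA].
  by rewrite inE => /eqP -> ->; rewrite addr0.
by exists v, 0; rewrite inE addr0.
Qed.

Lemma sumsetS A B C Z : A `<=` C -> B `<=` Z -> sumset A B `<=` sumset C Z.
Proof.
move=> /fsubsetP AC /fsubsetP BZ; apply/fsubsetP => v /sumsetP[a [b [aA bB ->]]].
by rewrite mem_sumset ?AC ?BZ.
Qed.

Lemma card_fsetM (S T : choiceType) (A : {fset S}) (B : {fset T}) :
  #|` A `*` B| = (#|` A| * #|` B|)%N.
Proof.
rewrite -(size_allpairs pair); apply/perm_size/uniq_perm.
- exact: fset_uniq.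
- by apply: allpairs_uniq => // -[x y] [x' y'].
move=> [x y]; rewrite in_fsetM; apply/andP/allpairsP => /=.
  by move=> [xA yB]; exists (x, y).
by move=> [[x' y'] /= [xA yB [-> ->]]].
Qed.

Lemma card_sumset_le A B : (#|` sumset A B| <= #|` A| * #|` B|)%N.
Proof.
rewrite -card_fsetM.
have -> : sumset A B = [fset p.1 + p.2 | p in A `*` B].
  apply/fsetP => v; apply/sumsetP/imfsetP => /=.
    by move=> [a [b [aA bB ->]]]; exists (a, b) => //; rewrite inE /= aA.
  by move=> [[a b]]; rewrite inE /= => /andP[aA bB] ->; exists a, b.
exact: leq_imfset_card.
Qed.

Lemma card_translate A v : #|` sumset A [fset v]| = #|` A|.
Proof.
have -> : sumset A [fset v] = [fset a + v | a in A].
  apply/fsetP => x; apply/sumsetP/imfsetP => /=.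
    by move=> [a [b [aA]]]; rewrite inE => /eqP -> ->; exists a.
  by move=> [a aA ->]; exists a, v; rewrite inE.
by rewrite card_imfset //; exact: addIr.
Qed.

Lemma card_sumset_ge A B : B != fset0 -> (#|` A| <= #|` sumset A B|)%N.
Proof.
move=> /fset0Pn[b bB]; rewrite -(card_translate A b).
by apply/fsubset_leq_card/sumsetS; rewrite ?fsub1set.
Qed.

Lemma sumsetUr A B C : sumset A (B `|` C) = sumset A B `|` sumset A C.
Proof.
apply/fsetP => v; rewrite inE; apply/sumsetP/orP.
  by move=> [a [b [aA]]]; rewrite inE => /orP[] bB ->; [left|right];
    rewrite mem_sumset.
by move=> [] /sumsetP[a [b [aA bB ->]]]; exists a, b; rewrite inE bB ?orbT.
Qed.

Lemma mem_nfoldS n A a v : a \in A -> v \in nfold n A -> a + v \in nfold n.+1 A.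
Proof. exact: mem_sumset. Qed.

(** * Inequalities of Ruzsa, Petridis and Plunnecke *)

(** Fix for each d in Y - Z a representation d = y_d - z_d; then
    (x, d) |-> (x + y_d, x + z_d) is injective, since d is recovered as a difference. *)
Lemma ruzsa_triangle X Y Z :
  (#|` X| * #|` sumset Y (oppset Z)| <= #|` sumset X Y| * #|` sumset X Z|)%N.
Proof.
pose D := sumset Y (oppset Z).
have rep d : exists p : V * V, d \in D -> [/\ p.1 \in Y, p.2 \in Z & d = p.1 - p.2].
  case: (boolP (d \in D)) => [/sumsetP[y [z [yY]]]|_]; last by exists (0, 0).
  by rewrite in_oppset => zZ ->; exists (y, - z); rewrite opprK.
pose r d := projT1 (cid (rep d)).
have rP d : d \in D -> [/\ (r d).1 \in Y, (r d).2 \in Z & d = (r d).1 - (r d).2].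
  exact: (projT2 (cid (rep d))).
rewrite -!card_fsetM.
pose f (p : V * V) := (p.1 + (r p.2).1, p.1 + (r p.2).2).
have finj : {in X `*` D &, injective f}.
  move=> [x d] [x' d'] /=; rewrite !inE /= => /andP[xX dD] /andP[x'X dD'].
  case=> e1 e2; have dd' : d = d'.
    have [_ _ ->] := rP _ dD; have [_ _ ->] := rP _ dD'.
    have shift (u v w : V) : u - v = w + u - (w + v).
      by rewrite opprD addrACA subrr add0r.
    by rewrite (shift _ _ x) e1 e2 -shift.
  by move: e1; rewrite dd' => /addIr ->.
rewrite -(card_in_imfset imfset_key finj).
apply/fsubset_leq_card/fsubsetP => p /imfsetP[[x d]] /=.
rewrite !inE /= => /andP[xX dD] ->; have [? ? _] := rP _ dD.
by rewrite !mem_sumset.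
Qed.

(** Induction on C. Adding c to C creates at most |Y + B| new sums, and those z + b + c
    for which the whole of z + B + c was already present are not new. If y + c was already in
    Y + C then y lies in the set Z of such z, so Y + C gains at least |Y| - |Z| points,
    and minimality of the ratio |Y + B| / |Y| among subsets of Y gives
    |Y + B| - |Z + B| <= (|Y + B| / |Y|) (|Y| - |Z|). *)
Lemma petridis Y B C :
  (forall Z, Z `<=` Y -> #|` sumset Y B| * #|` Z| <= #|` sumset Z B| * #|` Y|)%N ->
  (#|` sumset (sumset Y B) C| * #|` Y| <= #|` sumset Y B| * #|` sumset Y C|)%N.
Proof.
move=> Ymin; elim/fset1U_rect: C => [|c C cC IH].
  have -> : sumset (sumset Y B) fset0 = fset0.
    by apply/eqP; rewrite -fsubset0; apply/fsubsetP => v /sumsetP[a [b [_]]].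
  by rewrite cardfs0.
pose Z := [fset y in Y | sumset [fset y + c] B `<=` sumset (sumset Y B) C].
have ZY : Z `<=` Y by apply/fsubsetP => z; rewrite !inE => /andP[].
have hL : (#|` sumset (sumset Y B) (c |` C)| + #|` sumset Z B|
           <= #|` sumset (sumset Y B) C| + #|` sumset Y B|)%N.
  rewrite sumsetUr fsetUC -(card_translate (sumset Y B) c).
  rewrite -[leqRHS]cardfsUI leq_add2l -(card_translate (sumset Z B) c).
  apply/fsubset_leq_card/fsubsetP => v /sumsetP[s [c' []]].
  move=> /sumsetP[z [b [zZ bB ->]]] /fset1P -> ->.
  move: (zZ); rewrite !inE => /andP[zY /fsubsetP sub].
  apply/andP; split; last by rewrite !mem_sumset ?inE.
  by rewrite addrAC; apply: sub; rewrite !mem_sumset ?inE.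
have hR : (#|` sumset Y C| + #|` Y| <= #|` sumset Y (c |` C)| + #|` Z|)%N.
  rewrite sumsetUr fsetUC -(card_translate Y c) -cardfsUI leq_add2l.
  rewrite -(card_translate Z c).
  apply/fsubset_leq_card/fsubsetP => v; rewrite inE => /andP[vYC].
  move=> /sumsetP[y [c' [yY /fset1P -> vE]]].
  rewrite vE mem_sumset ?inE //= yY /=; apply/fsubsetP => u.
  move=> /sumsetP[s [b [/fset1P -> bB ->]]]; move: vYC; rewrite vE.
  move=> /sumsetP[y1 [c1 [yY1 cC1 ->]]].
  by rewrite addrAC !mem_sumset.
have := Ymin _ ZY; move: IH hL hR; clear.
nia.
Qed.

(** Ratios are compared by cross-multiplication. A set that is not itself a minimiser has
    a proper subset of smaller ratio, to which the induction hypothesis applies. *)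
Lemma petridis_minimizer A B : A != fset0 ->
  exists Y, [/\ Y `<=` A, Y != fset0,
    (#|` sumset Y B| * #|` A| <= #|` sumset A B| * #|` Y|)%N &
    forall Z, Z `<=` Y ->
      (#|` sumset Y B| * #|` Z| <= #|` sumset Z B| * #|` Y|)%N].
Proof.
elim/finSet_rect: A => A IH A0.
have [Amin|] := pselect (forall Z, Z `<=` A ->
    (#|` sumset A B| * #|` Z| <= #|` sumset Z B| * #|` A|)%N).
  by exists A.
move=> /existsNP[Z /not_implyP[ZA /negP]]; rewrite -ltnNge => ltZ.
have Z0 : Z != fset0.
  by apply: contraTneq ltZ => ->; rewrite cardfs0 muln0.
have propZ : Z `<` A.
  by rewrite fproperEneq ZA andbT; apply: contraTneq ltZ => ->; rewrite ltnn.
have [Y [YZ Y0 leY Ymin]] := IH Z propZ Z0.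
exists Y; split=> //; first exact: fsubset_trans ZA.
move: Z0; rewrite -cardfs_gt0 => Z0.
rewrite -(leq_pmul2r Z0); move: leY ltZ; clear; nia.
Qed.

(** The set Y minimising |Y + B| / |Y| inside A: each further copy of B multiplies
    the size of the sumset by at most K, by [petridis]. *)
Lemma plunnecke_growth A B K : A != fset0 ->
  (#|` sumset A B| <= K * #|` A|)%N ->
  exists Y, [/\ Y `<=` A, Y != fset0 &
    forall n, (#|` sumset Y (nfold n B)| <= K ^ n * #|` Y|)%N].
Proof.
move=> A0 AB; have [Y [YA Y0 leY Ymin]] := petridis_minimizer B A0.
have YB : (#|` sumset Y B| <= K * #|` Y|)%N.
  move: A0 leY AB; rewrite -cardfs_gt0; clear; nia.
exists Y; split=> //; elim=> [|n IH]; first by rewrite mul1n sumset0.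
move: Y0; rewrite -cardfs_gt0 => Y0.
have := petridis (nfold n B) Ymin; rewrite -sumsetA -/(nfold n.+1 B) => h.
rewrite -(leq_pmul2r Y0); apply: (leq_trans h).
rewrite expnS; move: YB IH; clear; nia.
Qed.

Lemma plunnecke_ruzsa A B K m n : A != fset0 ->
  (#|` sumset A B| <= K * #|` A|)%N ->
  (#|` sumset (nfold m B) (oppset (nfold n B))| <= K ^ (m + n) * #|` A|)%N.
Proof.
move=> A0 AB; have [Y [YA Y0 growth]] := plunnecke_growth A0 AB.
have := ruzsa_triangle Y (nfold m B) (nfold n B).
have := growth m; have := growth n.
have := fsubset_leq_card YA; move: Y0; rewrite -cardfs_gt0 expnD.
set u := #|` sumset Y _|; set v := #|` sumset Y _|; set w := #|` sumset _ _|.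
move: #|` A| #|` Y| (K ^ m)%N (K ^ n)%N => a y p q y0 ya uq vp h.
have {}h : (y * w <= y * (p * q * y))%N.
  apply: (leq_trans h); rewrite mulnC [leqRHS](_ : _ = q * y * (p * y))%N; last lia.
  by rewrite leq_mul.
rewrite leq_pmul2l // in h; apply: (leq_trans h).
by rewrite leq_mul2l ya orbT.
Qed.

(** X is a maximal subset of E whose translates x + A are pairwise disjoint: any other
    e in E has e + A meeting some x + A, so e \in x + A - A. It is built by adding the
    elements of E one at a time. *)
Lemma ruzsa_covering A E : A != fset0 ->
  exists X, (#|` X| * #|` A| <= #|` sumset E A|)%N /\
            E `<=` sumset X (sumset A (oppset A)).
Proof.
move=> A0; suff [X [XE XA cov]] : exists X, [/\ X `<=` E,
    #|` sumset X A| = (#|` X| * #|` A|)%N &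
    E `<=` sumset X (sumset A (oppset A))].
  by exists X; split=> //; rewrite -XA fsubset_leq_card // sumsetS.
elim/fset1U_rect: E => [|e E eE [X [XE XA cov]]].
  exists fset0; split=> //; rewrite ?fsub0set //.
  rewrite cardfs0; apply/eqP; rewrite cardfs_eq0 -fsubset0.
  by apply/fsubsetP => v /sumsetP[a [b []]].
have [eX|eX] := boolP (e \in sumset X (sumset A (oppset A))).
  exists X; split=> //; last by rewrite fsubUset fsub1set eX.
  by apply: (fsubset_trans XE); rewrite fsubsetUr.
have eNX : e \notin X by apply: contra eE => /(fsubsetP XE).
exists (e |` X); split; first by rewrite fsetUS.
  rewrite sumsetC sumsetUr cardfsU card_translate (sumsetC A X) XA.
  rewrite cardfsU1 eNX mulnDl mul1n; set I := _ `&` _.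
  suff -> : I = fset0 by rewrite cardfs0 subn0.
  apply/eqP; rewrite -fsubset0; apply/fsubsetP => v; rewrite in_fsetI.
  move=> /andP[/sumsetP[a [f [aA /fset1P -> ->]]] /sumsetP[x [b [xX bA]]]] xb.
  case/negP: eX; have -> : e = x + (b - a) by rewrite addrA -xb addrAC subrr add0r.
  by rewrite !mem_sumset ?in_oppset ?opprK.
rewrite fsubUset fsub1set; apply/andP; split.
  have [a aA] := fset0Pn _ A0.
  rewrite -[X in X \in _]addr0 -[X in _ + X](subrr a).
  by rewrite !mem_sumset ?in_oppset ?opprK // !inE eqxx.
by apply: (fsubset_trans cov); rewrite sumsetS ?fsubsetUr.
Qed.

(** * Multiples of a vector in an iterated difference set *)

Lemma fset_pigeonhole S X (f : V -> V) q :
  (forall s, s \in S -> f s \in X) -> (#|` X| * q < #|` S|)%N ->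
  exists2 x, x \in X & (q < #|` [fset s in S | f s == x]|)%N.
Proof.
elim/fset1U_rect: X S => [|x X xX IH] S fS ltS.
  have /fset0Pn[s /fS] : S != fset0 by rewrite -cardfs_gt0 (leq_trans _ ltS).
  by rewrite in_fset0.
pose Sx := [fset s in S | f s == x].
have [|ltx] := ltnP q #|` Sx|; first by exists x; rewrite // fset1U1.
have [||y yX lty] := IH (S `\` Sx).
- move=> s; rewrite !inE /= => /andP[]; rewrite negb_and => /orP[/negP //|fsx sS].
  by move: (fS s sS); rewrite !inE (negPf fsx).
- rewrite cardfsDS; last by apply/fsubsetP => s; rewrite !inE => /andP[].
  by move: ltS; rewrite cardfsU1 xX; move: ltx; clear; lia.
exists y; first by rewrite fset1Ur.
apply: (leq_trans lty); apply/fsubset_leq_card/fsubsetP => s.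
by rewrite !inE /= => /andP[/andP[_ ->] ->].
Qed.

(** For s in S write 2 g(s) = f(s) + h(s) with f(s) in X and h(s) in D. If s and s' have
    the same f, then doubling g s - g s' gives h s - h s', which is again a difference of
    elements of D. Pigeonholing on f costs a factor |X| and reduces t + 1 doublings to t
    doublings for h; the map g, rather than the inclusion of S in D, is there to make
    this induction possible. *)
Lemma doubling_itinerary D X S (g : V -> V) t :
  sumset D D `<=` sumset X D -> (forall s, s \in S -> g s \in D) ->
  (#|` X| ^ t < #|` S|)%N ->
  exists s s', [/\ s \in S, s' \in S, s != s' &
    forall i, (i <= t)%N -> (g s - g s') *+ 2 ^ i \in sumset D (oppset D)].
Proof.
move=> cov; elim: t S g => [|t IH] S g gS ltS.
  have [s sS] : exists s, s \in S by apply/fset0Pn; rewrite -cardfs_gt0 (leq_trans _ ltS).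
  have [s' ] : exists s', s' \in S `\ s.
    by apply/fset0Pn; rewrite -cardfs_gt0; move: ltS; rewrite (cardfsD1 s S) sS.
  rewrite !inE => /andP[ss' s'S]; exists s, s'; split=> //; first by rewrite eq_sym.
  by move=> i; rewrite leqn0 => /eqP ->; rewrite mulr1n mem_sumset ?in_oppset ?opprK ?gS.
have next s : exists p : V * V,
    s \in S -> [/\ p.1 \in X, p.2 \in D & g s *+ 2 = p.1 + p.2].
  have [sS|] := boolP (s \in S); last by exists (0, 0).
  have : g s *+ 2 \in sumset D D by rewrite mulr2n mem_sumset ?gS.
  by move=> /(fsubsetP cov)/sumsetP[x [d [? ? ?]]]; exists (x, d).
pose f s := (projT1 (cid (next s))).1; pose h s := (projT1 (cid (next s))).2.
have fhP s : s \in S -> [/\ f s \in X, h s \in D & g s *+ 2 = f s + h s].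
  exact: (projT2 (cid (next s))).
have [s sS||x xX ltx] := @fset_pigeonhole S X f (#|` X| ^ t)%N.
- by have [] := fhP s sS.
- by rewrite -expnS.
have [|s [s' []]] := IH _ h _ ltx.
  by move=> s; rewrite !inE => /andP[sS _]; have [] := fhP s sS.
rewrite !inE => /andP[sS /eqP fs] /andP[s'S /eqP fs'] ss' dbl.
exists s, s'; split=> // -[_|i it].
  by rewrite mulr1n mem_sumset ?in_oppset ?opprK ?gS.
rewrite expnS mulrnA mulrnBl.
have [_ _ ->] := fhP s sS; have [_ _ ->] := fhP s' s'S.
by rewrite fs fs' opprD addrACA subrr add0r dbl.
Qed.

(** Since addition commutes, an n-fold sum depends only on the multiplicities of its
    terms; this is what makes the growth of n-fold sumsets polynomial in n. *)
Lemma nfold_coords X n v : v \in nfold n X ->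
  exists c : X -> nat, (forall i, (c i <= n)%N) /\ v = \sum_(i : X) val i *+ c i.
Proof.
elim: n v => [|n IH] v.
  move=> /fset1P ->; exists (fun=> 0%N); split=> //.
  by rewrite big1 // => x _; rewrite mulr0n.
move=> /sumsetP[a [u [aX /IH[c [cn ->]] ->]]].
exists (fun i => (i == [` aX]) + c i)%N; split.
  by move=> x; rewrite -add1n leq_add // leq_b1.
under [RHS]eq_bigr do rewrite mulrnDr.
rewrite big_split /= [X in _ = X + _](bigD1 [` aX]) //= eqxx mulr1n.
rewrite [X in _ = _ + X + _]big1 ?addr0 //.
by move=> x /negPf ->; rewrite mulr0n.
Qed.

Lemma card_nfold_le X n : (#|` nfold n X| <= n.+1 ^ #|` X|)%N.
Proof.
pose f (c : {ffun X -> 'I_n.+1}) := \sum_(i : X) val i *+ c i.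
apply: (@leq_trans #|` [fset f c | c in {ffun X -> 'I_n.+1}]|).
  apply/fsubset_leq_card/fsubsetP => v /nfold_coords[c [cn ->]].
  apply/imfsetP; exists [ffun i => inord (c i)] => //=.
  by apply: eq_bigr => x _; rewrite ffunE inordK // ltnS.
apply: (leq_trans (leq_imfset_card _ _ _)).
by rewrite -cardE card_ffun card_ord -cardfE.
Qed.

Lemma nfold_covering D X n : sumset D D `<=` sumset X D ->
  nfold n.+1 D `<=` sumset (nfold n X) D.
Proof.
move=> cov; elim: n => [|n IH]; first by rewrite /nfold /= sumset0 sumsetC sumset0.
apply: (fsubset_trans (sumsetS (fsubset_refl D) IH)).
rewrite (sumsetC _ D) sumsetA (sumsetC _ (nfold n X)).
apply: (fsubset_trans (sumsetS (fsubset_refl _) cov)).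
by rewrite sumsetA (sumsetC (nfold n X)).
Qed.

Lemma nfold_mono D m n : 0 \in D -> (m <= n)%N -> nfold m D `<=` nfold n D.
Proof.
move=> D0 /subnK <-; elim: (n - m)%N => [//|k IH].
apply/fsubsetP => v /(fsubsetP IH) vk.
by rewrite addSn -[v]add0r mem_nfoldS.
Qed.

Definition progression w n : {fset V} := [fset w *+ val j | j in 'I_n].

(** Binary expansion of j: each of the t digits contributes 0 or a sum of two elements
    of D. *)
Lemma dyadic_progression D w t :
  0 \in D -> (forall i, (i < t)%N -> w *+ 2 ^ i \in sumset D D) ->
  progression w (2 ^ t) `<=` nfold t.*2 D.
Proof.
move=> D0; have add2 n v u : u \in sumset D D -> v \in nfold n D ->
    u + v \in nfold n.+2 D.
  by move=> /sumsetP[a [b [aD bD ->]]] vn; rewrite -addrA !mem_nfoldS.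
move=> dbl; apply/fsubsetP => v /imfsetP[[j jt] _ ->] /=.
elim: t j jt dbl => [|t IH] j jt dbl.
  by move: jt; rewrite ltnS leqn0 => /eqP ->; rewrite mulr0n inE.
have {}IH k : (k < 2 ^ t)%N -> w *+ k \in nfold t.*2 D.
  by move=> kt; apply: IH => // i it; apply: dbl; rewrite ltnW.
have [jt'|jt'] := ltnP j (2 ^ t).
  by apply: (fsubsetP (nfold_mono D0 _) _ (IH _ jt')); rewrite doubleS ltnW.
rewrite -(subnKC jt') mulrnDr doubleS add2 ?dbl // IH //.
by rewrite ltn_subLR // addnn -mul2n -expnS.
Qed.

(** The two sizes |3A - 2A| and |2A - A| control, respectively, the covering set X of
    D + D, where D = A - A, and the set A + D. Every multiple of w lies in D translated by
    a 2t-fold sum of X, so adding the progression to A costs only the polynomial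
    factor (2t+1)^|X|, although the progression has 2^t terms. *)
Lemma absorbed_progression A B K t :
  A != fset0 -> #|` B| = #|` A| -> (#|` sumset B A| <= K * #|` A|)%N ->
  ((K ^ 5) ^ t < #|` A|)%N ->
  exists2 w, w != 0 & (#|` sumset A (progression w (2 ^ t))| <=
    t.*2.+1 ^ (K ^ 5) * (K ^ 3 * #|` A|))%N.
Proof.
move=> A0 BA dbl ltA.
have B0 : B != fset0 by rewrite -cardfs_gt0 BA cardfs_gt0.
rewrite -BA in dbl.
have size3 := plunnecke_ruzsa 2 1 B0 dbl.
have size5 := plunnecke_ruzsa 3 2 B0 dbl.
have nfold2 a b : a \in A -> b \in A -> a + b \in nfold 2 A.
  by move=> aA bA; rewrite -[b]addr0 !mem_nfoldS ?inE.
pose D := sumset A (oppset A).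
have [X [cardX cov]] := ruzsa_covering (sumset D D) A0.
have {size5}cardX : (#|` X| <= K ^ 5)%N.
  rewrite -(@leq_pmul2r #|` A|) ?cardfs_gt0 // -[in leqRHS]BA.
  apply: (leq_trans cardX); apply: leq_trans size5; apply/fsubset_leq_card.
  apply/fsubsetP => v /sumsetP[d [a5 [/sumsetP[d1 [d2 [/sumsetP[a1 [a2 [aA1 aA2 ->]]]]]]]]].
  move=> /sumsetP[a3 [a4 [aA3 aA4 ->]]] -> aA5 ->.
  have -> : a1 + a2 + (a3 + a4) + a5 = a1 + (a3 + a5) + (a2 + a4).
    by rewrite (addrACA a1 a2 a3 a4) (addrAC (a1 + a3)) (addrA a1 a3 a5).
  rewrite !in_oppset in aA2 aA4.
  by rewrite mem_sumset ?in_oppset ?opprD ?nfold2 // mem_nfoldS ?nfold2.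
have {size3}cardAD : (#|` sumset A D| <= K ^ 3 * #|` A|)%N.
  rewrite -[in leqRHS]BA; apply: leq_trans size3; apply/fsubset_leq_card.
  rewrite /D sumsetA /nfold /= !sumset0; exact: fsubset_refl.
have D0 : 0 \in D.
  by have [a aA] := fset0Pn _ A0; rewrite -(subrr a) mem_sumset ?in_oppset ?opprK.
have Dopp : oppset D `<=` D.
  apply/fsubsetP => v; rewrite in_oppset => /sumsetP[a [b [aA bA]]] vab.
  rewrite -[v]opprK vab opprD addrC mem_sumset //; first by rewrite -in_oppset.
  by rewrite in_oppset opprK.
have ltD : (#|` X| ^ t < #|` D|)%N.
  have leX : (#|` X| ^ t <= (K ^ 5) ^ t)%N by case: (t) => // n; rewrite leq_exp2r.
  apply: (leq_ltn_trans leX); apply: (leq_trans ltA).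
  by rewrite card_sumset_ge // -cardfs_gt0 card_oppset cardfs_gt0.
have [|s [s' [_ _ ss' step]]] := doubling_itinerary (g := id) cov _ ltD; first by [].
exists (s - s'); first by rewrite subr_eq0.
have inD : progression (s - s') (2 ^ t) `<=` sumset (nfold t.*2 X) D.
  apply: fsubset_trans (nfold_covering _ cov).
  apply: fsubset_trans (nfold_mono D0 (leqnSn _)).
  apply: dyadic_progression => // i it.
  exact: (fsubsetP (sumsetS (fsubset_refl D) Dopp)) (step i (ltnW it)).
apply: (leq_trans (fsubset_leq_card (sumsetS (fsubset_refl A) inD))).
rewrite sumsetA (sumsetC A) -sumsetA; apply: (leq_trans (card_sumset_le _ _)).
rewrite leq_mul //; apply: (leq_trans (card_nfold_le _ _)).
by rewrite leq_pexp2l.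
Qed.

End Sumsets.

(** * Sumsets and parallel lines *)

Section Fibres.
Variables (V : zmodType) (R : realFieldType).
Implicit Types (A B : {fset V}) (v w a b : V) (l : {additive V -> R}).

Definition fibre l A (y : R) : {fset V} := [fset a in A | l a == y].

Lemma in_fibre l A y a : (a \in fibre l A y) = (a \in A) && (l a == y).
Proof. by rewrite !inE. Qed.

Lemma fibre_sub l A y : fibre l A y `<=` A.
Proof. by apply/fsubsetP => a; rewrite in_fibre => /andP[]. Qed.

Lemma top_fibre l A : A != fset0 ->
  exists2 y, fibre l A y != fset0 & forall a, a \in A -> l a <= y.
Proof.
move=> A0; suff [a aA amax] : exists2 a, a \in A & forall b, b \in A -> l b <= l a.
  by exists (l a) => //; apply/fset0Pn; exists a; rewrite in_fibre aA eqxx.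
elim/fset1U_rect: A A0 => [|a A aA IH _]; first by rewrite eqxx.
have [->|A0] := eqVneq (A : {fset V}) fset0.
  by exists a; rewrite ?inE ?eqxx // => b; rewrite !inE orbF => /eqP ->.
have [c cA cmax] := IH A0; have [le|lt] := leP (l a) (l c).
  by exists c; rewrite ?inE ?cA ?orbT // => b; rewrite !inE => /orP[/eqP ->|/cmax].
exists a; rewrite ?inE ?eqxx // => b; rewrite !inE => /orP[/eqP ->//|/cmax h].
exact: le_trans h (ltW lt).
Qed.

(** Sums of two top fibres take the value y + z under l, while all sums counted in the
    first term take a smaller value. *)
Lemma sumset_peel_top l A B y z :
  (forall a, a \in A -> l a <= y) -> (forall b, b \in B -> l b <= z) ->
  (#|` sumset (A `\` fibre l A y) B| +
   #|` sumset (fibre l A y) (fibre l B z)| <= #|` sumset A B|)%N.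
Proof.
move=> ymax zmax; set S1 := sumset _ B; set S2 := sumset _ (fibre l B z).
have S12 : S1 `&` S2 = fset0.
  apply/eqP; rewrite -fsubset0; apply/fsubsetP => v; rewrite in_fsetI.
  move=> /andP[/sumsetP[a [b []]]]; rewrite in_fsetD in_fibre.
  move=> /andP[aNy aA] bB -> /sumsetP[a' [b' []]]; rewrite !in_fibre.
  move=> /andP[_ /eqP la] /andP[_ /eqP lb] /(congr1 l); rewrite !raddfD /= la lb => e.
  have lay : l a < y by rewrite lt_neqAle ymax // andbT; move: aNy; rewrite aA.
  by have := ltr_leD lay (zmax b bB); rewrite e ltxx.
rewrite -cardfsUI S12 cardfs0 addn0; apply: fsubset_leq_card.
by rewrite fsubUset !sumsetS ?fsubsetDl ?fibre_sub.
Qed.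

Lemma line_sumset l A B : A != fset0 -> B != fset0 ->
  {in A &, injective l} -> {in B &, injective l} ->
  (#|` A| + #|` B| <= #|` sumset A B|.+1)%N.
Proof.
elim/finSet_rect: A => A IH A0 B0 lA lB.
have [y Ay ymax] := top_fibre l A0; have [z Bz zmax] := top_fibre l B0.
have [a aAy] := fset0Pn _ Ay; have [aA /eqP lay] : a \in A /\ l a == y.
  by apply/andP; rewrite -in_fibre.
have AyE : fibre l A y = [fset a].
  apply/fsetP => c; rewrite in_fibre inE; apply/andP/eqP => [[cA /eqP lc]|->].
    by apply: lA => //; rewrite lc.
  by rewrite lay.
have := sumset_peel_top ymax zmax; rewrite AyE.
have [A'0|A'0] := eqVneq (A `\` [fset a]) fset0.
  move=> _; have -> : A = [fset a].
    by apply/eqP; rewrite eqEfsubset fsub1set aA andbT -fsetD_eq0 A'0.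
  by rewrite sumsetC card_translate cardfs1.
have sub : A `\` [fset a] `<` A by rewrite fproperD1.
have := IH _ sub A'0 B0 _ lB; rewrite (cardfsD1 a A) aA => h1 h2.
have {}h1 : (#|` A `\ a| + #|` B| <= #|` sumset (A `\ a) B|.+1)%N.
  apply: h1 => c d; rewrite !inE => /andP[_ cA] /andP[_ dA]; exact: lA.
have : (0 < #|` sumset [fset a] (fibre l B z)|)%N.
  by rewrite sumsetC card_translate cardfs_gt0.
by move: h1 h2; clear; lia.
Qed.

Lemma card_image_peel l A y : fibre l A y != fset0 ->
  #|` l @` A| = #|` l @` (A `\` fibre l A y)|.+1.
Proof.
move=> /fset0Pn[a]; rewrite in_fibre => /andP[aA /eqP lay].
rewrite (cardfsD1 y) -{1}lay in_imfset //= add1n.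
suff -> : (l @` A) `\ y = l @` (A `\` fibre l A y) by [].
apply/fsetP => x; rewrite !inE; apply/andP/imfsetP => /=.
  move=> [xy /imfsetP[b bA xb]]; exists b; rewrite // !inE /= bA andbT.
  by rewrite -xb.
move=> [b]; rewrite in_fsetD in_fibre => /andP[bNy bA ->]; split.
  by move: bNy; rewrite bA.
exact: in_imfset.
Qed.

Lemma fibre_full l A y : fibre l A y != fset0 -> #|` l @` A| = 1%N ->
  fibre l A y = A.
Proof.
move=> Ay; rewrite (card_image_peel Ay) => -[/eqP]; rewrite cardfs_eq0 => /eqP lA'0.
apply/eqP; rewrite eqEfsubset fibre_sub -fsetD_eq0 /=; apply/negPn/negP.
by move=> /fset0Pn[c cA']; have := in_imfset imfset_key l cA'; rewrite lA'0 inE.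
Qed.

(** Here p and q are the average fibre sizes of two sets with m and n fibres, a and b are
    the sizes of their top fibres. The two hypotheses are the inductive bounds obtained
    by removing the top fibre from one set or from the other, multiplied by m - 1 and
    n - 1. With these weights the contributions of a and b cancel; keeping them as
    factors, instead of dividing by them, makes the hypothesis for a set with a single
    fibre degenerate to 0 <= 0. *)
Lemma weighted_average (m n p q a b S : R) : 0 < m + n - 2 ->
  (m + n - 2) * (p * m - a + (m - 1) * (q - 1)) + (m - 1) * (a + b - 1)
    <= (m - 1) * S ->
  (m + n - 2) * (q * n - b + (n - 1) * (p - 1)) + (n - 1) * (a + b - 1)
    <= (n - 1) * S ->
  (p + q - 1) * (m + n - 1) <= S.
Proof. by move=> mn0 h1 h2; rewrite -(ler_pM2l mn0); lra. Qed.

(** Induction on |A| + |B|: peel the top fibre off either set with [sumset_peel_top],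
    bound the sum of the two top fibres by the one-dimensional inequality, and average
    the two resulting bounds with [weighted_average]. When both sets consist of one
    fibre, the one-dimensional inequality is the claim. *)
Lemma sumset_line_cover l l' A B : (forall v, l v = 0 -> l' v = 0 -> v = 0) ->
  A != fset0 -> B != fset0 ->
  let m := #|` l @` A|%:R : R in let n := #|` l @` B|%:R : R in
  (#|` A|%:R / m + #|` B|%:R / n - 1) * (m + n - 1) <= #|` sumset A B|%:R.
Proof.
move=> ll'; have [k] := ubnP (#|` A| + #|` B|).
elim: k A B => // k IH A B; rewrite ltnS => szAB A0 B0 /=.
have [y Ay ymax] := top_fibre l A0; have [z Bz zmax] := top_fibre l B0.
have lineS : #|` fibre l A y|%:R + #|` fibre l B z|%:R - 1
    <= #|` sumset (fibre l A y) (fibre l B z)|%:R :> R.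
  have inj C x : {in fibre l C x &, injective l'}.
    move=> c d; rewrite !in_fibre => /andP[_ /eqP lc] /andP[_ /eqP ld] l'cd.
    apply/eqP; rewrite -subr_eq0; apply/eqP/ll'; rewrite raddfB /=.
      by rewrite lc ld subrr.
    by rewrite l'cd subrr.
  by rewrite lerBlDr -natrD natr1 ler_nat (line_sumset Ay Bz (inj _ _) (inj _ _)).
(* The inductive bound after peeling C, used below for both A and B. *)
have peel C D x u : C != fset0 -> D != fset0 -> (#|` C| + #|` D| <= k)%N ->
    (forall c, c \in C -> l c <= x) -> (forall d, d \in D -> l d <= u) ->
    fibre l C x != fset0 -> fibre l D u != fset0 ->
    #|` fibre l C x|%:R + #|` fibre l D u|%:R - 1
      <= #|` sumset (fibre l C x) (fibre l D u)|%:R :> R ->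
    let m := #|` l @` C|%:R : R in let n := #|` l @` D|%:R : R in
    let a := #|` fibre l C x|%:R : R in let b := #|` fibre l D u|%:R : R in
    (m + n - 2) * (#|` C|%:R - a + (m - 1) * (#|` D|%:R / n - 1))
      + (m - 1) * (a + b - 1) <= (m - 1) * #|` sumset C D|%:R.
  move=> C0 D0 szCD xmax umax Cx Du lineCD /=.
  set C' := C `\` fibre l C x; set a := #|` fibre l C x|.
  have cardC : (#|` C| = #|` C'| + a)%N.
    by rewrite cardfsDS ?fibre_sub // subnK // fsubset_leq_card // fibre_sub.
  rewrite (card_image_peel Cx) -/C' cardC.
  have [C'0|C'0] := eqVneq C' fset0.
    have -> : l @` C' = fset0 by rewrite C'0 imfset0.
    by rewrite C'0 !cardfs0 add0n !subrr !mul0r !(addr0, mulr0).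
  have a0 : (0 < a)%N by rewrite cardfs_gt0.
  have szC' : (#|` C'| + #|` D| < k)%N by move: szCD a0; rewrite cardC; clear; lia.
  have := IH C' D szC' C'0 D0; rewrite /=.
  set m := #|` l @` C'|; set n := #|` l @` D| => ih.
  have m0 : 0 < m%:R :> R.
    rewrite ltr0n cardfs_gt0; have [c cC] := fset0Pn _ C'0.
    by apply/fset0Pn; exists (l c); apply: in_imfset.
  have := sumset_peel_top xmax umax; rewrite -/C' -(ler_nat R) natrD => peelS.
  rewrite -natr1 natrD -/a addrK addrK.
  have pE : #|` C'|%:R = #|` C'|%:R / m%:R * m%:R :> R by field; rewrite gt_eqF.
  rewrite pE; move: ih peelS lineCD; rewrite -/a.
  set p := #|` C'|%:R / _; set q := _ / n%:R => ih peelS lineCD.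
  rewrite (le_trans _ (ler_wpM2l (ltW m0) (le_trans (lerD ih lineCD) peelS))) //.
  lra.
have i1 := peel A B y z A0 B0 szAB ymax zmax Ay Bz lineS.
have i2 : _ := peel B A z y B0 A0 _ zmax ymax Bz Ay.
rewrite (sumsetC B) (sumsetC (fibre l B z)) (addnC #|` B|) in i2.
rewrite (addrC #|` fibre l B z|%:R #|` fibre l A y|%:R) in i2.
have {}i2 := i2 szAB lineS.
have pos C : C != fset0 -> (0 < #|` l @` C|)%N.
  move=> /fset0Pn[c cC]; rewrite cardfs_gt0; apply/fset0Pn.
  by exists (l c); apply: in_imfset.
have := pos A A0; have := pos B B0; move: i1 i2 => /=.
set m := #|` l @` A|; set n := #|` l @` B| => i1 i2 n0 m0.
have m0R : m%:R != 0 :> R by rewrite pnatr_eq0 -lt0n.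
have n0R : n%:R != 0 :> R by rewrite pnatr_eq0 -lt0n.
have [mn1|mn1] := leqP (m + n) 2.
  have [m1 n1] : m = 1%N /\ n = 1%N by move: m0 n0 mn1; clear; lia.
  move: lineS; rewrite (fibre_full Ay m1) (fibre_full Bz n1) m1 n1 => lineS.
  by apply: le_trans lineS; rewrite !divr1; lra.
have NA : #|` A|%:R = #|` A|%:R / m%:R * m%:R :> R by field.
have NB : #|` B|%:R = #|` B|%:R / n%:R * n%:R :> R by field.
apply: (weighted_average (a := #|` fibre l A y|%:R) (b := #|` fibre l B z|%:R)).
- by rewrite subr_gt0 -natrD ltr_nat.
- by rewrite -NA.
- by rewrite -NB; move: i2; lra.
Qed.

(** The pair (l, l') embeds A in a grid. *)
Lemma card_le_projections l l' A : (forall v, l v = 0 -> l' v = 0 -> v = 0) ->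
  (#|` A| <= #|` l @` A| * #|` l' @` A|)%N.
Proof.
move=> ll'; rewrite -card_fsetM.
have inj : {in A &, injective (fun v => (l v, l' v))}.
  move=> a b _ _ [la l'a]; apply/eqP; rewrite -subr_eq0; apply/eqP/ll'.
    by rewrite raddfB /= la subrr.
  by rewrite raddfB /= l'a subrr.
rewrite -(card_in_imfset imfset_key inj); apply/fsubset_leq_card/fsubsetP.
by move=> p /imfsetP[a aA ->]; rewrite in_fsetM /= !in_imfset.
Qed.

(** A translate of the progression is contained in a fibre of l, so one point chosen in
    each fibre of A yields disjoint translates. *)
Lemma progression_lines l l' A w n : l w = 0 -> l' w != 0 ->
  (#|` l @` A| * n <= #|` sumset A (progression w n)|)%N.
Proof.
move=> lw l'w.
have cardP : #|` progression w n| = n.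
  rewrite card_in_imfset => [|i j _ _ /(congr1 l')]; first by rewrite -cardE card_ord.
  by rewrite !raddfMn /= => /(mulrIn l'w)/val_inj.
have rep y : exists a, y \in l @` A -> a \in A /\ l a = y.
  have [/imfsetP[a aA ->]|_] := boolP (y \in l @` A); first by exists a.
  by exists 0.
pose r y := projT1 (cid (rep y)).
have rP y : y \in l @` A -> r y \in A /\ l (r y) = y := projT2 (cid (rep y)).
have lP p : p \in progression w n -> l p = 0.
  by move=> /imfsetP[i _ ->]; rewrite raddfMn /= lw mul0rn.
rewrite -{1}cardP -card_fsetM.
have inj : {in (l @` A) `*` progression w n &, injective (fun q => r q.1 + q.2)}.
  move=> [y p] [z q]; rewrite !in_fsetM /= => /andP[yA pP] /andP[zA qP] e.
  have yz : y = z.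
    move/(congr1 l): e; rewrite !raddfD /= (lP _ pP) (lP _ qP) !addr0.
    by have [_ ->] := rP y yA; have [_ ->] := rP z zA.
  by move: e; rewrite yz => /addrI ->.
rewrite -(card_in_imfset imfset_key inj); apply/fsubset_leq_card/fsubsetP.
move=> v /imfsetP[[y p]]; rewrite /= in_fsetM /= => /andP[yA pP] ->.
by rewrite mem_sumset //; have [] := rP y yA.
Qed.

(** With p = N/m <= n and q = N/n <= m, the product expands to at least
    p n + q m + 2 N - 2 (m + n), and p n + q m >= 2 N by the arithmetic-geometric mean
    inequality. When n >= 4 m the single term p n >= 4 N suffices. *)
Lemma four_card_bound (N m n S : R) : 1 <= m -> 1 <= n -> n <= N -> N <= m * n ->
  (N / m + N / n - 1) * (m + n - 1) <= S -> 4 * N - 10 * m <= S.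
Proof.
move=> m1 n1 nN Nmn; apply: le_trans.
have m0 : 0 < m by exact: lt_le_trans m1.
have n0 : 0 < n by exact: lt_le_trans n1.
have pE : N = N / m * m by field; rewrite gt_eqF.
have qE : N = N / n * n by field; rewrite gt_eqF.
set p := N / m in pE *; set q := N / n in qE *.
have pn : p <= n by rewrite ler_pdivrMr // mulrC.
have qm : q <= m by rewrite ler_pdivrMr.
have q1 : 1 <= q by rewrite ler_pdivlMr // mul1r.
have p0 : 0 <= p by rewrite divr_ge0 ?(le_trans _ nN) // ltW.
have [nm|nm] := leP (4 * m) n.
  have h1 : 0 <= (q - 1) * (m + n - 1) by rewrite mulr_ge0 //; lra.
  have h2 : 0 <= p * (m - 1) by rewrite mulr_ge0 //; lra.
  have h3 : 0 <= p * (n - 4 * m) by rewrite mulr_ge0 //; lra.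
  lra.
have amgm : 2 * N <= p * n + q * m.
  rewrite -subr_ge0 -(pmulr_rge0 _ n0).
  have e : q * n = p * m by rewrite -pE -qE.
  clearbody p q; rewrite pE.
  have -> : n * (p * n + q * m - 2 * (p * m)) =
      p * (n - m) ^+ 2 + m * (q * n - p * m) by ring.
  rewrite e subrr mulr0 addr0.
  by rewrite mulr_ge0 ?sqr_ge0.
lra.
Qed.
End Fibres.

(** * Lines and rotations in the plane *)

Section Plane.
Variable R : realType.
Implicit Types (v w : 'cV[R]_2) (theta : R).

(** The fibres of [det2 w] are the lines of direction w. *)
Definition det2 w v : R := w 0 0 * v 1 0 - w 1 0 * v 0 0.

Fact det2_is_zmod_morphism w : zmod_morphism (det2 w).
Proof. by move=> u v; rewrite /det2 !mxE; ring. Qed.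

HB.instance Definition _ w :=
  GRing.isZmodMorphism.Build 'cV[R]_2 R (det2 w) (det2_is_zmod_morphism w).

Lemma cV2_eq0 v : v 0 0 = 0 -> v 1 0 = 0 -> v = 0.
Proof.
move=> v0 v1; apply/matrixP => i j; rewrite !mxE (ord1 j).
by case: i => -[|[|//]] lt; [rewrite -v0|rewrite -v1]; congr (v _ _); apply/val_inj.
Qed.

Lemma rotation0E theta v :
  rotation theta v 0 0 = cos theta * v 0 0 - sin theta * v 1 0.
Proof.
rewrite /rotation mxE !big_ord_recl big_ord0 !mxE /= addr0 mulNr.
by rewrite (_ : lift ord0 ord0 = 1) //; apply/val_inj.
Qed.

Lemma rotation1E theta v :
  rotation theta v 1 0 = sin theta * v 0 0 + cos theta * v 1 0.
Proof.
rewrite /rotation mxE !big_ord_recl big_ord0 !mxE /= addr0.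
by rewrite (_ : lift ord0 ord0 = 1) //; apply/val_inj.
Qed.

Lemma rotation_inj theta : injective (rotation theta).
Proof.
move=> u v uv; apply/eqP; rewrite -subr_eq0; apply/eqP.
have := cos2Dsin2 theta; set c := cos theta; set s := sin theta => cs.
set x := u 0 0 - v 0 0; set y := u 1 0 - v 1 0.
have e0 : c * x - s * y = 0.
  have := congr1 (fun z : 'cV[R]_2 => z 0 0) uv.
  by rewrite !rotation0E -/c -/s /x /y; lra.
have e1 : s * x + c * y = 0.
  have := congr1 (fun z : 'cV[R]_2 => z 1 0) uv.
  by rewrite !rotation1E -/c -/s /x /y; lra.
apply: cV2_eq0; rewrite !mxE -?/x -?/y.
  have -> : x = c * (c * x - s * y) + s * (s * x + c * y).
    by rewrite -[LHS]mul1r -cs; ring.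
  by rewrite e0 e1 !mulr0 addr0.
have -> : y = c * (s * x + c * y) - s * (c * x - s * y).
  by rewrite -[LHS]mul1r -cs; ring.
by rewrite e0 e1 !mulr0 subr0.
Qed.

(** The lines of direction w meeting the rotated set correspond to the lines of the
    inversely rotated direction meeting the original set. *)
Lemma det2_rotation theta w v :
  det2 w (rotation theta v) = det2 (rotation (- theta) w) v.
Proof.
by rewrite /det2 !rotation0E !rotation1E cosN sinN; ring.
Qed.

(** A rotation whose sine is nonzero fixes no direction, so two lines, one of direction w
    and one of direction the rotated w, meet in at most one point. *)
Lemma det2_rotation_inj theta w v : sin theta != 0 -> w != 0 ->
  det2 w v = 0 -> det2 (rotation (- theta) w) v = 0 -> v = 0.
Proof.
move=> s0 w0; rewrite -det2_rotation /det2 rotation0E rotation1E.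
set a := w 0 0; set b := w 1 0; set x := v 0 0; set y := v 1 0 => e0 e1.
have e2 : a * x + b * y = 0.
  apply: (mulfI s0); rewrite mulr0 -[RHS]e1.
  transitivity (sin theta * (a * x + b * y) + cos theta * (a * y - b * x)); last ring.
  by rewrite e0 mulr0 addr0.
have ab : a ^+ 2 + b ^+ 2 != 0.
  apply: contraNneq w0 => /eqP; rewrite paddr_eq0 ?sqr_ge0 // !sqrf_eq0.
  by move=> /andP[/eqP a0 /eqP b0]; rewrite (cV2_eq0 a0 b0).
apply: cV2_eq0; apply: (mulfI ab); rewrite mulr0 -?/x -?/y.
  transitivity (a * (a * x + b * y) - b * (a * y - b * x)); first by ring.
  by rewrite e0 e2 !mulr0 subr0.
transitivity (b * (a * x + b * y) + a * (a * y - b * x)); first by ring.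
by rewrite e0 e2 !mulr0 addr0.
Qed.

Lemma sin_neq0 theta : 0 < theta -> theta < 2 * pi -> theta <> pi -> sin theta != 0.
Proof.
move=> t0 t2 tpi; have [lt|lt|//] := ltgtP theta pi.
  by rewrite gt_eqF // sin_gt0_pi // t0.
have : 0 < sin (theta - pi) by apply: sin_gt0_pi; apply/andP; split; lra.
rewrite sinB cospi sinpi mulr0 subr0 mulrN1 oppr_gt0 => h.
by rewrite lt_eqF.
Qed.

End Plane.

(** * Asymptotics and conclusion *)

(** With u = t / j one has t + 1 <= j (u + 1) <= j 2^u, and the j-th power of 2^u is at
    most 2^t. *)
Lemma polynomial_le_exponential j : (0 < j)%N ->
  exists C, forall t, (t.*2.+1 ^ j <= C * 2 ^ t)%N.
Proof.
move=> j0; exists ((2 * j) ^ j)%N => t.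
have step : (t.*2.+1 <= 2 * j * 2 ^ (t %/ j))%N.
  rewrite -mulnA; apply: (@leq_trans (2 * t.+1)%N); first by clear; lia.
  rewrite leq_mul2l /=; apply: (leq_trans (ltn_ceil t j0)).
  by rewrite mulnC leq_mul2l ltn_expl ?orbT.
apply: (@leq_trans ((2 * j * 2 ^ (t %/ j)) ^ j)); first by rewrite leq_exp2r.
by rewrite expnMn leq_mul2l -expnM leq_pexp2l ?orbT // leq_trunc_div.
Qed.

(** The first bound gives m = O(N / sqrt T) and the second T >= N^(1/10) / 2. In terms
    of s = N^(1/20) these read (m s)^2 <= 2 C N^2, and N^(1 - 1/20) = N / s. *)
Lemma power_saving (R : realType) (N m T C : R) : 1 <= N -> 0 <= m -> 0 <= T ->
  0 <= C ->
  m ^+ 2 * T <= C * N ^+ 2 -> N <= (2 * T) ^+ 10 ->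
  m <= (2 * C + 1) * N `^ (1 - 20^-1).
Proof.
move=> N1 m0 T0 C0 hm hN.
have N0 : 0 < N by lra.
pose s := N `^ 20^-1.
have s0 : 0 < s by rewrite powR_gt0.
have sN : s ^+ 20 = N.
  by rewrite -powR_mulrn ?ltW // -powRrM mulVf ?pnatr_eq0 // powRr1 // ltW.
have -> : N `^ (1 - 20^-1) = N / s.
  by rewrite powRB ?powRr1 ?ltW //; apply/implyP => _; rewrite gt_eqF.
rewrite mulrA ler_pdivlMr //.
have sT : s ^+ 2 <= 2 * T.
  rewrite -(@ler_pXn2r _ 10) ?nnegrE ?sqr_ge0 ?mulr_ge0 //.
  by rewrite -exprM sN.
rewrite -(@ler_pXn2r _ 2) ?nnegrE ?mulr_ge0 ?(ltW s0) ?(ltW N0) //; last by lra.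
rewrite !exprMn; apply: (@le_trans _ _ (2 * C * N ^+ 2)).
  apply: (le_trans (ler_wpM2l (sqr_ge0 m) sT)); lra.
rewrite ler_wpM2r ?sqr_ge0 //; nra.
Qed.

Theorem corollary1p4 (R : realType) :
  exists delta : R, 0 < delta /\
  exists K : R, 0 < K /\
  forall (A : {fset 'cV[R]_2}) (theta : R),
    0 < theta -> theta < 2 * pi -> theta <> pi ->
    4 * (#|` A|)%:R - K * (#|` A|)%:R `^ (1 - delta)
      <= (#|` sumset A [fset rotation theta a | a in A]|)%:R.
Proof.
(* k is kept abstract so that no unary numeral of this size is ever unfolded. *)
have [k kE] : exists k, k = (4 ^ 5)%N by exists (4 ^ 5)%N.
have k0 : (0 < k)%N by rewrite kE expn_gt0.
have [C growth] : exists C, forall t, (t.*2.+1 ^ (k * 2) <= C * 2 ^ t)%N.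
  by apply: polynomial_le_exponential; rewrite muln_gt0 k0.
pose C' : R := C%:R * (4 ^ 3)%:R ^+ 2.
have C'0 : 0 <= C' by rewrite mulr_ge0 ?sqr_ge0.
exists 20^-1; split; first by rewrite invr_gt0.
(* The extra 4 takes care of sets with at most one point. *)
exists (10 * (2 * C' + 1) + 4); split; first by lra.
move=> A theta t0 t2 tpi; have s0 := sin_neq0 t0 t2 tpi.
set B := [fset rotation theta a | a in A]; set N := #|` A|; set K := _ + 4.
have BN : #|` B| = N by rewrite card_imfset //; exact: rotation_inj.
have K4 : 4 <= K by rewrite /K; lra.
have [N1|N2] := leqP N 1.
  have NN : N%:R = N%:R `^ (1 - 20^-1) :> R.
    case: (N) N1 => [|[|//]] _; last by rewrite powR1.
    by rewrite powR0 // gt_eqF // subr_gt0 invf_lt1 ?ltr1n.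
  rewrite -NN -mulrBl; apply: (@le_trans _ _ 0) => //.
  by rewrite mulr_le0_ge0 // subr_le0.
have [big|small] := leqP (4 * N) #|` sumset A B|.
  apply: (@le_trans _ _ (4 * N)%:R); last by rewrite ler_nat.
  by rewrite natrM lerBlDr lerDl mulr_ge0 ?powR_ge0 //; lra.
have A0 : A != fset0 by rewrite -cardfs_gt0 ltnW.
have B0 : B != fset0 by rewrite -cardfs_gt0 BN ltnW.
have k1 : (1 < k)%N by rewrite kE -[1%N](exp1n 5) ltn_exp2r.
(* t is the largest exponent allowed by the pigeonhole step; since k = 2^10, the
   progression length 2^t is about N^(1/10). *)
have /andP[] := up_log_bounds k1 N2; set t := (up_log k N).-1 => ltN.
have -> : up_log k N = t.+1 by rewrite prednK // up_log_gt0 k1.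
move=> Nle.
have [w w0 linesA] : exists2 w, w != 0 &
    (#|` sumset A (progression w (2 ^ t))| <= t.*2.+1 ^ k * (4 ^ 3 * N))%N.
  rewrite kE; apply: (absorbed_progression A0 BN).
    by rewrite sumsetC ltnW.
  by rewrite -kE.
pose l := det2 w; pose l' := det2 (rotation (- theta) w).
have ll' v : l v = 0 -> l' v = 0 -> v = 0 by apply: det2_rotation_inj.
have lw : l w = 0 by rewrite /l /det2 mulrC subrr.
have l'w : l' w != 0 by apply: contraNneq w0 => l'w0; rewrite (ll' w).
set m := #|` l @` A|; pose n := #|` l @` B|.
have nE : n = #|` l' @` A|.
  rewrite /n /B -imfset_comp /=; congr (size (enum_fset _)).
  by apply: eq_imfset => // a; exact: det2_rotation.
have {}linesA : (m * 2 ^ t <= t.*2.+1 ^ k * (4 ^ 3 * N))%N.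
  exact: leq_trans (progression_lines A (2 ^ t) lw l'w) linesA.
have pos (f : 'cV[R]_2 -> R) (E : {fset 'cV[R]_2}) : E != fset0 -> (0 < #|` f @` E|)%N.
  move=> /fset0Pn[c cE]; rewrite cardfs_gt0; apply/fset0Pn.
  by exists (f c); apply: in_imfset.
have bound : 4 * N%:R - 10 * m%:R <= #|` sumset A B|%:R :> R.
  have := sumset_line_cover ll' A0 B0; rewrite BN -/m -/n -/N; apply: four_card_bound.
  - by rewrite ler1n pos.
  - by rewrite ler1n pos.
  - by rewrite ler_nat nE leq_imfset_card.
  - by rewrite -natrM ler_nat nE card_le_projections.
(* Squaring makes room to absorb the polynomial factor in one of the two 2^t. *)
have m2 : (m ^ 2 * 2 ^ t <= C * ((4 ^ 3) ^ 2 * N ^ 2))%N.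
  rewrite -(@leq_pmul2r (2 ^ t)) ?expn_gt0 // -[leqLHS]mulnA mulnn -expnMn.
  apply: (@leq_trans ((t.*2.+1 ^ k * (4 ^ 3 * N)) ^ 2)); first by rewrite leq_exp2r.
  by rewrite expnMn -expnM (expnMn _ N) [leqRHS]mulnAC leq_mul2r growth orbT.
have mle : m%:R <= (2 * C' + 1) * N%:R `^ (1 - 20^-1).
  apply: (@power_saving R _ _ (2 ^ t)%:R) => //.
  - by rewrite ler1n ltnW.
  - by rewrite /C' -!natrX -!natrM ler_nat -mulnA.
  - rewrite -natrM -expnS -natrX ler_nat -expnM.
    have k2 : k = (2 ^ 10)%N by rewrite kE -[4%N]/(2 ^ 2)%N -expnM.
    by apply: (leq_trans Nle); rewrite k2 -expnM mulnC.
apply: le_trans bound; rewrite lerD2l lerN2 /K [leRHS]mulrDl.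
apply: (@le_trans _ _ (10 * ((2 * C' + 1) * N%:R `^ (1 - 20^-1)))).
  by rewrite ler_pM2l.
by rewrite mulrA lerDl mulr_ge0 ?powR_ge0.
Qed.
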